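(* Let $d \geq 3$. The Diestel–Leader group $\Gamma_d(q)$ is graph automatic: with respect to its generating set $S_{d,q}$, there exist a finite set of symbols $\Lambda$ and a regular language $L \subseteq \Lambda^*$ in bijection with $\Gamma_d(q)$ such that for every $x \in S_{d,q}$ the language $L_x=\{\otimes(u,v) \mid u,v\in L,\ \bar v = \bar u x \text{ in } \Gamma_d(q)\}$ is regular.
   Context: Standing assumptions: $q \geq 2$ and $d\ge 3$ are integers, the coefficient ring is $\mathbb{Z}_q$, and $l_1,\dots,l_{d-1}\in\mathbb{Z}_q$ are distinct elements such that each $l_i$ is invertible and each difference $l_i-l_j$ ($i\neq j$) is invertible. Let $\mathcal{R}_d=\mathbb{Z}_q[t,(t+l_1)^{-1},\dots,(t+l_{d-1})^{-1}]$. The Diestel–Leader group $\Gamma_d(q)$ is the group (under matrix multiplication) of matrices $\begin{pmatrix} (t+l_1)^{m_1}\cdots(t+l_{d-1})^{m_{d-1}} & P\\ 0 & 1\end{pmatrix}$ with $m_1,\dots,m_{d-1}\in\mathbb{Z}$ and $P\in\mathcal{R}_d$. Its generating set $S_{d,q}$ consists of the matrices $\begin{pmatrix} t+l_i & b\\ 0&1\end{pmatrix}^{\pm1}$ for $b\in\mathbb{Z}_q$, $1\le i\le d-1$, and $\begin{pmatrix} (t+l_i)(t+l_j)^{-1} & -b(t+l_j)^{-1}\\ 0&1\end{pmatrix}$ for $b\in\mathbb{Z}_q$, $1\le i,j\le d-1$, $i\neq j$. Convolution: for a finite alphabet $\Lambda$ and a symbol $\diamond\notin\Lambda$, the convolution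 $\otimes(w_1,\dots,w_k)$ of words $w_1,\dots,w_k\in\Lambda^*$ is the word of length $\max_i|w_i|$ over the alphabet $(\Lambda\cup\{\diamond\})^k$ whose $p$-th letter is the column $(\lambda_1,\dots,\lambda_k)^T$, where $\lambda_r$ is the $p$-th letter of $w_r$ if $p\le |w_r|$ and $\diamond$ otherwise. For $u\in L$, $\bar u$ denotes the group element corresponding to $u$ under the bijection. *)

(* Defs.v *)
From HB Require Import structures.
From mathcomp Require Import all_boot all_order all_algebra.
Set Implicit Arguments. Unset Strict Implicit. Unset Printing Implicit Defensive.
Import GRing.Theory.
Local Open Scope ring_scope.

(* ---------- The ring R_d = Z_q[t, (t+l_1)^-1, ..., (t+l_n)^-1], n = d-1 ----------
   An element is represented by a pair (p, k) standing for the fraction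
   p / prod_i (t + l_i)^(k i), with p : {poly 'Z_q}.  Since every t + l_i is
   monic (a non-zero-divisor), two fractions are equal in R_d iff they are
   equal after cross-multiplication (req). *)

Definition den (q n : nat) (l : 'I_n -> 'Z_q) (k : 'I_n -> nat) : {poly 'Z_q} :=
  \prod_(i < n) ('X + (l i)%:P) ^+ k i.

Definition Rd (q n : nat) := ({poly 'Z_q} * ('I_n -> nat))%type.

Definition req (q n : nat) (l : 'I_n -> 'Z_q) (a b : Rd q n) : Prop :=
  a.1 * den l b.2 = b.1 * den l a.2.

Definition radd (q n : nat) (l : 'I_n -> 'Z_q) (a b : Rd q n) : Rd q n :=
  (a.1 * den l b.2 + b.1 * den l a.2, fun i => (a.2 i + b.2 i)%N).

Definition rmul (q n : nat) (a b : Rd q n) : Rd q n :=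
  (a.1 * b.1, fun i => (a.2 i + b.2 i)%N).

Definition ropp (q n : nat) (a : Rd q n) : Rd q n := (- a.1, a.2).

Definition zpos (z : int) : nat := match z with Posz m => m | Negz _ => 0%N end.
Definition zneg (z : int) : nat := match z with Posz _ => 0%N | Negz m => m.+1 end.

(* the unit (t+l_1)^(e 1) ... (t+l_n)^(e n) of R_d *)
Definition mono (q n : nat) (l : 'I_n -> 'Z_q) (e : 'I_n -> int) : Rd q n :=
  (den l (fun i => zpos (e i)), fun i => zneg (e i)).

(* ---------- The Diestel--Leader group Gamma_d(q) ----------
   (e, P) represents the matrix [[ prod_i (t+l_i)^(e i), P ], [0, 1]]. *)
Definition DLgroup (q n : nat) := (('I_n -> int) * Rd q n)%type.

(* matrix product: [[a,P],[0,1]] [[b,Q],[0,1]] = [[ab, aQ+P],[0,1]] *)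
Definition dlmul (q n : nat) (l : 'I_n -> 'Z_q) (g h : DLgroup q n) : DLgroup q n :=
  (fun i => g.1 i + h.1 i, radd l (rmul (mono l g.1) h.2) g.2).

(* matrix inverse: [[a,P],[0,1]]^-1 = [[a^-1, -a^-1 P],[0,1]] *)
Definition dlinv (q n : nat) (l : 'I_n -> 'Z_q) (g : DLgroup q n) : DLgroup q n :=
  (fun i => - g.1 i, ropp (rmul (mono l (fun i => - g.1 i)) g.2)).

Definition dleq (q n : nat) (l : 'I_n -> 'Z_q) (g h : DLgroup q n) : Prop :=
  req l (mono l g.1) (mono l h.1) /\ req l g.2 h.2.

Definition unitv (n : nat) (i : 'I_n) : 'I_n -> int :=
  fun j => if i == j then 1 else 0.

(* [[t + l_i, b],[0,1]] *)
Definition gen1 (q n : nat) (i : 'I_n) (b : 'Z_q) : DLgroup q n :=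
  (unitv i, (b%:P, fun _ => 0%N)).

(* [[(t+l_i)(t+l_j)^-1, -b (t+l_j)^-1],[0,1]] *)
Definition gen2 (q n : nat) (i j : 'I_n) (b : 'Z_q) : DLgroup q n :=
  (fun k => unitv i k - unitv j k, (- b%:P, fun k => if j == k then 1%N else 0%N)).

Definition in_S (q n : nat) (l : 'I_n -> 'Z_q) (x : DLgroup q n) : Prop :=
  exists (i : 'I_n) (b : 'Z_q),
    [\/ x = gen1 i b, x = dlinv l (gen1 i b) | exists j : 'I_n, i != j /\ x = gen2 i j b].

Record dfa (A : finType) := DFA {
  dfa_state : finType;
  dfa_s : dfa_state;
  dfa_fin : pred dfa_state;
  dfa_trans : dfa_state -> A -> dfa_state }.

Definition dfa_accept (A : finType) (M : dfa A) (w : seq A) : bool :=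
  @dfa_fin A M (foldl (@dfa_trans A M) (@dfa_s A M) w).

Definition regular (A : finType) (L : seq A -> Prop) : Prop :=
  exists M : dfa A, forall w, L w <-> dfa_accept M w.

(* convolution of two words; the padding symbol diamond is None *)
Definition conv (A : Type) (u v : seq A) : seq (option A * option A) :=
  mkseq (fun p => (onth u p, onth v p)) (maxn (size u) (size v)).

Arguments den {q n} l k.
Arguments req {q n} l a b.
Arguments radd {q n} l a b.
Arguments mono {q n} l e.
Arguments dlmul {q n} l g h.
Arguments dlinv {q n} l g.
Arguments dleq {q n} l g h.
Arguments in_S {q n} l x.

(* Main.v *)
(* Write [g = (e, P)] and put [P' = P / mono e].  Right multiplication by
   [x = (s, Q)] sends [(e, P')] to [(e + s, (P' + Q) / mono s)], an operation that
   does not depend on [e].  The partial fraction expansion of [P'] has one string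
   of digits for the polynomial part and one for each pole [- l_i], and multiplying
   by [t + l_i] only mixes neighbouring digits.  Written in columns, next to signed
   unary encodings of the [e_i], the relation [v = u x] for [x] in [S_{d,q}] is
   therefore a condition on consecutive columns.
   Instead of evaluating expansions, one lets [Z_q[t]] act on them: each [t + l_i]
   acts bijectively because the differences [l_i - l_j] are units, so every fraction
   has exactly one expansion. *)
Require Import Defs.
From HB Require Import structures.
From mathcomp Require Import all_boot all_order all_algebra.
From mathcomp Require Import zify ring.
Set Implicit Arguments. Unset Strict Implicit. Unset Printing Implicit Defensive.
Import GRing.Theory.
Local Open Scope ring_scope.

(** * Local languages *)

Section Words.
Variables (A : eqType) (z : A).
Implicit Types (u v : seq A) (f : nat -> A).

(** Passing through [Some] makes the empty word trimmed. Trimmed words thus correspond exactly to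
    the sequences that are eventually [z]. *)
Definition trimmed u := last None (map Some u) != Some z.

Lemma trimmed_cons a u : trimmed (a :: u) = if u is [::] then a != z else trimmed u.
Proof. by case: u. Qed.

Lemma trimmed_nth0 u : trimmed u -> (forall p, nth z u p = z) -> u = [::].
Proof.
elim: u => // a u IHu; rewrite trimmed_cons => tu eq_z.
have u0: u = [::].
  case: u tu IHu eq_z => // b u tu IHu eq_z.
  by apply: IHu tu _ => p; apply: (eq_z p.+1).
by move: tu; rewrite u0 (eq_z 0%N : a = z) eqxx.
Qed.

Lemma trimmed_inj u v : trimmed u -> trimmed v -> nth z u =1 nth z v -> u = v.
Proof.
elim: u v => [|a u IHu] v tu tv eq_uv.
  by apply/esym/trimmed_nth0 => // p; rewrite -eq_uv nth_nil.
case: v tv eq_uv => [|b v] tv eq_uv.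
  by apply: trimmed_nth0 => // p; rewrite eq_uv nth_nil.
congr (_ :: _); first exact: (eq_uv 0%N).
apply: IHu => [||p]; last exact: (eq_uv p.+1).
  by move: tu; rewrite trimmed_cons; case: (u).
by move: tv; rewrite trimmed_cons; case: (v).
Qed.

Lemma trimmed_exists f :
  (exists N, forall p, (N <= p)%N -> f p = z) ->
  exists2 u, trimmed u & nth z u =1 f.
Proof.
case=> N; elim: N f => [|N IHN] f f0.
  by exists [::] => // p; rewrite nth_nil f0.
have [|u tu uf] := IHN (fun p => f p.+1).
  by move=> p leNp; apply: f0.
case: u tu uf => [|a u] tu uf; last first.
  by exists (f 0%N :: a :: u) => // -[|p] //=; apply: uf.
have [f00|nf0] := eqVneq (f 0%N) z.
  by exists [::] => // -[|p]; rewrite nth_nil // -uf nth_nil.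
by exists [:: f 0%N] => // -[|p] //=; rewrite -uf !nth_nil.
Qed.

End Words.

(** Serves to read the two component words back from the letters of a convolution. *)
Lemma onth_exists (A : Type) (f : nat -> option A) :
  (exists N, f N = None) -> (forall p, f p = None -> f p.+1 = None) ->
  exists u : seq A, forall p, onth u p = f p.
Proof.
case=> N; elim: N f => [|N IHN] f fN stop.
  by exists [::] => p; rewrite onth0n; elim: p => // p /esym/stop.
case f0: (f 0%N) => [a|]; last first.
  by exists [::] => p; rewrite onth0n; elim: p => // p /esym/stop.
have [p|u uf] := IHN (fun p => f p.+1) fN; first exact: stop.
by exists (a :: u) => -[|p] //=; rewrite f0.
Qed.

Lemma nth_conv (A : Type) (u v : seq A) p :
  nth (None, None) (conv u v) p = (onth u p, onth v p).
Proof.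
have [lt_p|le_p] := ltnP p (maxn (size u) (size v)); first by rewrite nth_mkseq.
rewrite nth_default ?size_mkseq //.
by move: le_p; rewrite geq_max => /andP[pu pv]; rewrite !onth_default.
Qed.

Lemma trimmed_conv (A : eqType) (u v : seq A) : trimmed (None, None) (conv u v).
Proof.
have nilE (w : seq A) p: onth w p = None -> (size w <= p)%N.
  by rewrite -onthNE => ->.
rewrite /trimmed; have: size (conv u v) = maxn (size u) (size v) by rewrite size_mkseq.
case/lastP: (conv u v) (nth_conv u v) => // w b uvE; rewrite size_rcons => szw.
rewrite map_rcons last_rcons; apply/eqP=> -[bE]; have := uvE (size w).
rewrite nth_rcons ltnn eqxx bE => -[/esym/nilE su /esym/nilE sv].
have: (maxn (size u) (size v) <= size w)%N by rewrite geq_max su.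
by rewrite -szw ltnn.
Qed.

(** The word is continued by [z] forever: [c] also has to hold between the last letter and [z], and
    between [z] and itself. *)
Definition local_lang (B : finType) (z : B) (c0 : pred B) (c : rel B) (w : seq B) : Prop :=
  [/\ trimmed z w, c0 (nth z w 0) & forall p, c (nth z w p) (nth z w p.+1)].

Section LocalRegular.
Variables (B : finType) (z : B) (c0 : pred B) (c : rel B).

Definition local_ok (prev : option B) b := if prev is Some a then c a b else c0 b.

(** A state keeps a flag for the conditions checked so far and the last letter read, [None] at the
    start. Acceptance checks the infinite continuation by [z], for which two comparisons suffice,
    and trimmedness. *)
Definition local_dfa : dfa B :=
  @DFA B (bool * option B)%type (true, None)
    (fun s => [&& s.1, local_ok s.2 z, c z z & s.2 != Some z])
    (fun s b => (s.1 && local_ok s.2 b, Some b)).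

Lemma local_regular : regular (local_lang z c0 c).
Proof.
exists local_dfa => w; rewrite /dfa_accept /=.
rewrite /local_lang /trimmed.
suff gen ok prev: [&& ok, local_ok prev (nth z w 0) & last prev (map Some w) != Some z]
    /\ (forall p, c (nth z w p) (nth z w p.+1)) <->
    dfa_fin (foldl (@dfa_trans _ local_dfa) (ok, prev : option B) w).
  rewrite -(gen true None) /=; split=> [[-> -> H] //|[/andP[-> ->] H] //].
elim: w ok prev => [|b w IHw] ok prev /=.
  split=> [[/and3P[-> -> ->] czz]|/and4P[-> -> czz ->]]; first by rewrite (czz 0%N).
  by split=> // -[|p] //=; rewrite !nth_nil.
rewrite -IHw /=; split=> [[/and3P[-> -> ->] H]|[/and3P[/andP[-> ->] H0 ->] H]].
  by rewrite (H 0%N); split=> // p; apply: (H p.+1).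
by split=> // -[|p] //=.
Qed.

End LocalRegular.

(* A relation between trimmed words that is local in the columns is recognised
   on convolutions: the shape of a convolution is itself a local condition. *)
Section ConvRegular.
Variables (A : finType) (z : A) (d0 : pred (A * A)) (d : rel (A * A)).

(** A word may not stop right after a [z], which is trimmedness, and padding once begun never
    ends. *)
Definition pad_ok (a a' : option A) :=
  if a is Some x then (x == z) ==> (a' != None) else a' == None.

(** Reading the padding as [z] lets [d0] and [d] be tested past the end of the shorter word. *)
Definition fill (b : option A * option A) := (odflt z b.1, odflt z b.2).

Lemma pad_okP (u : seq A) :
  reflect (forall p, pad_ok (onth u p) (onth u p.+1)) (trimmed z u).
Proof.
apply: (iffP idP) => [|H].
  elim: u => [|a u IHu]; first by move=> _ p; rewrite !onth0n.
  rewrite trimmed_cons => tu [|p] /=.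
    case: u tu {IHu} => [/negPf/= -> //|b u _ /=].
    by rewrite implybT.
  by apply: IHu; case: u tu.
elim: u H => // a u IHu H; rewrite trimmed_cons.
have := H 0%N; case: u IHu H => [|b u] IHu H /= H0.
  by apply: contraL H0 => ->.
by apply: IHu => p; apply: (H p.+1).
Qed.

Lemma conv_regular :
  regular (fun w => exists u v, [/\ trimmed z u, trimmed z v, w = conv u v &
     d0 (nth z u 0, nth z v 0) /\
     forall p, d (nth z u p, nth z v p) (nth z u p.+1, nth z v p.+1)]).
Proof.
have [M MP] := local_regular (None, None) (fun b => d0 (fill b))
  (fun b b' => [&& pad_ok b.1 b'.1, pad_ok b.2 b'.2 & d (fill b) (fill b')]).
exists M => w; rewrite -MP {M MP}; split.
  case=> u [v [/pad_okP tu /pad_okP tv -> [H0 H]]]; split=> [||p].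
  - exact: trimmed_conv.
  - by rewrite nth_conv /fill !odflt_onth.
  - rewrite !nth_conv; apply/and3P; split; [exact: tu | exact: tv |].
    by rewrite /fill !odflt_onth; apply: H.
case=> tw H0 H.
have sup p: (size w <= p)%N -> nth (None, None) w p = (None, None) by apply: nth_default.
have [||u uE] := @onth_exists A (fun p => (nth (None, None) w p).1).
- by exists (size w); rewrite sup.
- by move=> p; case/and3P: (H p) => + _ _; case: (nth _ w p).1 => // /eqP.
have [||v vE] := @onth_exists A (fun p => (nth (None, None) w p).2).
- by exists (size w); rewrite sup.
- by move=> p; case/and3P: (H p) => _ + _; case: (nth _ w p).2 => // /eqP.
exists u, v; split.
- by apply/pad_okP=> p; rewrite !uE; case/and3P: (H p).
- by apply/pad_okP=> p; rewrite !vE; case/and3P: (H p).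
- apply: trimmed_inj tw _ _; first exact: trimmed_conv.
  by move=> p; rewrite nth_conv uE vE; case: nth.
split=> [|p]; rewrite -!odflt_onth !uE !vE //.
by case/and3P: (H p).
Qed.

End ConvRegular.

(** * Partial fractions *)

Section PartialFractions.
Variables (q n : nat) (l : 'I_n -> 'Z_q).

(* [(A, C)] stands for [A + \sum_j \sum_k (C j)`_k (t + l_j)^-(k+1)]. *)
Definition pfrac := ({poly 'Z_q} * {ffun 'I_n -> {poly 'Z_q}})%type.
Implicit Types (D E : pfrac) (p r : {poly 'Z_q}) (k : 'I_n -> nat).

(* Multiplication by [t], since [t (t + l_j)^-(k+1) = (t + l_j)^-k - l_j (t + l_j)^-(k+1)]. *)
Definition mult D : pfrac :=
  ('X * D.1 + (\sum_j (D.2 j)`_0)%:P,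
   [ffun j => drop_poly 1 (D.2 j) - l j *: D.2 j]).

Lemma multD D E : mult (D + E) = mult D + mult E.
Proof.
congr (_, _) => /=.
  rewrite mulrDr addrACA -polyCD -big_split; congr (_ + _%:P).
  by apply: eq_bigr => j _; rewrite ffunE coefD.
by apply/ffunP => j; rewrite !ffunE drop_polyD scalerDr opprD addrACA.
Qed.

Lemma multZ c D : mult (c *: D) = c *: mult D.
Proof.
congr (_, _) => /=.
  rewrite scalerDr scalerAr -!mul_polyC -polyCM mulr_sumr; congr (_ + _%:P).
  by apply: eq_bigr => j _; rewrite ffunE coefZ.
by apply/ffunP => j; rewrite !ffunE drop_polyZ scalerBr !scalerA mulrC.
Qed.

Lemma mult0 : mult 0 = 0.
Proof. by have := multZ 0 0; rewrite !scale0r. Qed.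

(** This is [p] evaluated at the endomorphism [mult], which turns expansions into a module over the
    polynomial ring. *)
Definition act p D := \sum_(i < size p) p`_i *: iter i mult D.

Lemma act_widen p N D : (size p <= N)%N -> act p D = \sum_(i < N) p`_i *: iter i mult D.
Proof.
move=> leN; rewrite /act (big_ord_widen N (fun i => p`_i *: iter i mult D) leN).
rewrite big_mkcond; apply: eq_bigr => i _; case: ltnP => // le_i.
by rewrite nth_default // scale0r.
Qed.

Lemma actDl p r D : act (p + r) D = act p D + act r D.
Proof.
rewrite (@act_widen (p + r) (maxn (size p) (size r))) ?size_polyD //.
rewrite (@act_widen p (maxn (size p) (size r))) ?leq_maxl //.
rewrite (@act_widen r (maxn (size p) (size r))) ?leq_maxr //.
by rewrite -big_split; apply: eq_bigr => i _; rewrite coefD scalerDl.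
Qed.

Lemma actZl c p D : act (c *: p) D = c *: act p D.
Proof.
rewrite (@act_widen _ (size p)) ?size_scale_leq // scaler_sumr.
by apply: eq_bigr => i _; rewrite coefZ scalerA.
Qed.

Lemma act0l D : act 0 D = 0.
Proof. by rewrite /act size_poly0 big_ord0. Qed.

Lemma actC c D : act c%:P D = c *: D.
Proof. by rewrite (@act_widen _ 1) ?size_polyC_leq1 // big_ord1 coefC. Qed.

Lemma actMX p D : act (p * 'X) D = mult (act p D).
Proof.
rewrite (@act_widen _ (size p).+1); last first.
  by apply: leq_trans (size_polyMleq _ _) _; rewrite size_polyX addn2.
rewrite big_ord_recl coefMX eqxx scale0r add0r.
have -> : mult (act p D) = \sum_(i < size p) mult (p`_i *: iter i mult D).
  exact: (big_morph mult multD mult0).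
by apply: eq_bigr => i _; rewrite coefMX /= multZ.
Qed.

Lemma actDr p D E : act p (D + E) = act p D + act p E.
Proof.
rewrite -big_split; apply: eq_bigr => i _ /=; rewrite -scalerDr; congr (_ *: _).
by elim: (i : nat) => //= m ->; rewrite multD.
Qed.

Lemma actZr c p D : act p (c *: D) = c *: act p D.
Proof.
rewrite scaler_sumr; apply: eq_bigr => i _ /=; rewrite scalerA mulrC -scalerA.
by congr (_ *: _); elim: (i : nat) => //= m ->; rewrite multZ.
Qed.

Lemma actBr p D E : act p (D - E) = act p D - act p E.
Proof. by rewrite actDr -scaleN1r actZr scaleN1r. Qed.

Lemma actM p r D : act (p * r) D = act p (act r D).
Proof.
elim/poly_ind: p => [|p c IHp]; first by rewrite mul0r !act0l.
by rewrite mulrDl mul_polyC mulrAC !actDl actZl actC !actMX IHp.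
Qed.

Lemma actCA p r D : act p (act r D) = act r (act p D).
Proof. by rewrite -!actM mulrC. Qed.

Definition pconst p : pfrac := (p, 0).

Lemma act_pconst p r : act p (pconst r) = pconst (p * r).
Proof.
elim/poly_ind: p => [|p c IHp]; first by rewrite mul0r act0l.
rewrite actDl actMX actC IHp mulrDl mul_polyC; congr (_, _) => /=.
  rewrite big1 ?addr0 => [|j _]; last by rewrite ffunE coef0.
  by rewrite mulrAC mulrC.
by apply/ffunP => j; rewrite !ffunE drop_poly0r !scaler0 subrr addr0.
Qed.

Lemma act1 D : act 1 D = D.
Proof. by rewrite actC scale1r. Qed.

(** * Bijectivity of the action of the linear factors *)

Definition xl i : {poly 'Z_q} := 'X + (l i)%:P.

(** At the pole [i] the scalar [l i - l j] vanishes and a pure shift of digits remains. At the other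
    poles the shift is perturbed by a scalar that will be a unit. *)
Lemma act_xl i D : act (xl i) D =
  (xl i * D.1 + (\sum_j (D.2 j)`_0)%:P,
   [ffun j => drop_poly 1 (D.2 j) + (l i - l j) *: D.2 j]).
Proof.
rewrite actDl -['X]mul1r actMX act1 actC; congr (_, _) => /=.
  by rewrite mulrDl mul_polyC addrAC.
by apply/ffunP => j; rewrite !ffunE scalerBl addrAC addrA.
Qed.

(** [drop_poly 1] lowers the degree, so the top coefficient of the image is [u] times that of
    [p]. *)
Lemma drop_scale_inj (u : 'Z_q) p : u \is a GRing.unit ->
  drop_poly 1 p + u *: p = 0 -> p = 0.
Proof.
move=> Uu p0; apply/eqP; apply: contraT => nz.
have /eqP := congr1 (fun r : {poly 'Z_q} => r`_(size p).-1) p0.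
rewrite coefD coef_drop_poly addn1 prednK ?size_poly_gt0 // nth_default // add0r.
rewrite coefZ coef0 => /eqP/(congr1 ( *%R u^-1)); rewrite mulKr // mulr0 => /eqP.
by rewrite lead_coef_eq0 (negPf nz).
Qed.

Lemma drop_scale_surj (u : 'Z_q) r : u \is a GRing.unit ->
  exists p, drop_poly 1 p + u *: p = r.
Proof.
move=> Uu; move: {2}(size r) (leqnn (size r)) => N; elim: N r => [|N IHN] r szr.
  exists 0; rewrite drop_poly0r scaler0 addr0.
  by apply/esym/eqP; rewrite -size_poly_leq0.
have [|p pE] := IHN (drop_poly 1 r); first by rewrite size_drop_poly leq_subLR.
(* With [S] the shift, [(S + u)^-1 r = u^-1 (r - (S + u)^-1 S r)], and [p] is the solution for
   [S r]. *)
exists (u^-1 *: (r - p)).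
rewrite drop_polyZ scalerA divrr // scale1r raddfB /= scalerBr.
rewrite -{1}pE scalerDr scalerA mulVr // scale1r.
by rewrite [X in X + _]addrAC subrr add0r addrC subrK.
Qed.

Lemma mult_const_inj i p (c : 'Z_q) : xl i * p + c%:P = 0 -> p = 0 /\ c = 0.
Proof.
move=> H; suff p0 : p = 0.
  by move: H; rewrite p0 mulr0 add0r => /eqP; rewrite polyC_eq0 => /eqP.
apply/eqP; apply: contraT => nz.
have szM : size (xl i * p) = (size p).+1.
  by rewrite mulrC size_Mmonic ?monicXaddC // size_XaddC addn2.
have: (size (xl i * p)%R <= 1)%N.
  by rewrite -[xl i * p]opprK (addr0_eq H) size_polyN size_polyC_leq1.
by rewrite szM ltnS size_poly_leq0 (negPf nz).
Qed.

Lemma drop_poly1_eq0 p : drop_poly 1 p = 0 -> p = (p`_0)%:P.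
Proof.
move=> p0; apply/polyP => -[|m]; rewrite coefC //=.
by have := coef_drop_poly 1 p m; rewrite p0 coef0 addn1 => <-.
Qed.

Definition regular_action p :=
  (forall D, act p D = 0 -> D = 0) /\ (forall E, exists D, act p D = E).

Lemma regular_actM p r : regular_action p -> regular_action r -> regular_action (p * r).
Proof.
move=> [p_inj p_surj] [r_inj r_surj]; split=> [D|E].
  by rewrite actM => /p_inj/r_inj.
have [F <-] := p_surj E; have [D <-] := r_surj F.
by exists D; rewrite actM.
Qed.

Hypothesis l_unit : forall i j, i != j -> l i - l j \is a GRing.unit.

(** Away from [i] each polar part is handled on its own through the unit [l i - l j]. At [i] the
    shift loses exactly the lowest digit, and that digit compensates for the remainder of the
    polynomial part modulo [xl i]. *)
Lemma regular_act_xl i : regular_action (xl i).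
Proof.
split=> [[A C]|[A C]].
  rewrite act_xl => -[/= /mult_const_inj[-> sum0] /ffunP C0].
  have Cj j : j != i -> C j = 0.
    move=> nij; apply: (@drop_scale_inj (l i - l j)); first by rewrite l_unit // eq_sym.
    by have := C0 j; rewrite !ffunE.
  have Ci : C i = ((C i)`_0)%:P.
    by apply: drop_poly1_eq0; have := C0 i; rewrite !ffunE subrr scale0r addr0.
  congr (_, _); apply/ffunP => j; rewrite ffunE.
  have [->|/Cj//] := eqVneq j i; rewrite Ci.
  by move: sum0; rewrite (bigD1 i) //= big1 ?addr0 => [->|k /Cj ->]; rewrite ?coef0.
have /fin_all_exists[F FE] : forall j, exists p, j != i -> drop_poly 1 p + (l i - l j) *: p = C j.
  move=> j; have [_|nij] := eqVneq j i; first by exists 0.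
  by have [|p pE] := @drop_scale_surj (l i - l j) (C j); [rewrite l_unit // eq_sym | exists p].
have /factor_theorem[Q QE] : root (A - (A.[- l i])%:P) (- l i).
  by rewrite /root hornerD hornerN hornerC subrr.
(* The digit lost by the shift at [i] is free. This choice makes the lowest digits of all poles sum
   to [A.[- l i]], the remainder of [A] on division by [xl i]. *)
pose s := A.[- l i] - \sum_(j | j != i) (F j)`_0.
exists (Q, [ffun j => if j == i then C i * 'X + s%:P else F j]).
rewrite act_xl; congr (_, _) => /=.
  rewrite (bigD1 i) //= ffunE eqxx coefD coefMX coefC /= add0r.
  have -> : s + \sum_(j | j != i)
      ([ffun j => if j == i then C i * 'X + s%:P else F j] j)`_0 = A.[- l i].
    rewrite (eq_bigr (fun j => (F j)`_0)) ?subrK // => j /negPf nij.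
    by rewrite ffunE nij.
  by rewrite /xl -[l i]opprK polyCN mulrC -QE opprK subrK.
apply/ffunP => j; rewrite !ffunE; case: eqVneq => [->|/FE //].
rewrite subrr scale0r addr0 addrC -['X]expr1 drop_polyDMXn //.
by rewrite size_polyC_leq1.
Qed.


Lemma regular_act1 : regular_action 1.
Proof. by split=> [D|E]; [rewrite act1 | exists E; rewrite act1]. Qed.

Lemma regular_act_den k : regular_action (den l k).
Proof.
apply: (big_ind regular_action regular_act1 regular_actM) => i _.
elim: (k i) => [|m IHm]; first exact: regular_act1.
by rewrite exprS; apply: regular_actM (regular_act_xl i) IHm.
Qed.

Lemma regular_act_inj p D E : regular_action p -> act p D = act p E -> D = E.
Proof.
by case=> p_inj _ eqDE; apply/eqP; rewrite -subr_eq0; apply/eqP/p_inj; rewrite actBr eqDE subrr.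
Qed.

(** * Denominators and uniqueness of exponents *)

Lemma den_add k k1 k2 : (forall i, k i = k1 i + k2 i)%N -> den l k = den l k1 * den l k2.
Proof. by move=> kE; rewrite -big_split; apply: eq_bigr => i _; rewrite kE exprD. Qed.

Lemma den0 k : (forall i, k i = 0%N) -> den l k = 1.
Proof. by move=> kE; rewrite /den big1 // => i _; rewrite kE expr0. Qed.

Lemma den1 i k : (forall j, k j = (i == j)) -> den l k = xl i.
Proof.
move=> kE; rewrite /den (bigD1 i) //= kE eqxx expr1 big1 ?mulr1 // => j nij.
by rewrite kE eq_sym (negPf nij) expr0.
Qed.

Lemma xl_lreg i m : GRing.lreg (xl i ^+ m).
Proof. by apply: monic_lreg; rewrite monic_exp // monicXaddC. Qed.

(** If [k' i < k i], cancel the monic power [xl i ^+ k' i] and evaluate at [- l i]: one side is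
    zero, the other a product of powers of the units [l j - l i]. *)
Lemma den_leq k k' i : den l k = den l k' -> (k i <= k' i)%N.
Proof.
rewrite /den (bigD1 i) // [RHS](bigD1 i) //= => den_eq; rewrite leqNgt; apply/negP => lt_k.
move: den_eq; rewrite -/(xl i) -(subnKC (ltnW lt_k)) exprD -mulrA => /xl_lreg.
move/(congr1 (horner^~ (- l i))); rewrite hornerM horner_exp !hornerE addNr.
have -> : (k i - k' i)%N = (k i - (k' i).+1).+1 by rewrite subnSK.
rewrite expr0n mul0r => /esym/eqP; rewrite horner_prod => /eqP prod0.
have : \prod_(j < n | j != i) (('X + (l j)%:P) ^+ k' j).[- l i] \is a GRing.unit.
  apply: (big_ind (fun x => x \is a GRing.unit)) => [|x y ux uy|j nij].
  - exact: unitr1.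
  - by rewrite unitrM ux.
  - by rewrite horner_exp !hornerE unitrX // addrC l_unit.
by rewrite prod0 unitr0.
Qed.

Lemma den_inj k k' : den l k = den l k' -> k =1 k'.
Proof. by move=> E i; apply/eqP; rewrite eqn_leq !den_leq. Qed.

Lemma zpos_sub_zneg (z : int) : (zpos z)%:Z - (zneg z)%:Z = z.
Proof. by case: z => m /=; lia. Qed.

Lemma req_mono_inj (e e' : 'I_n -> int) : req l (mono l e) (mono l e') -> e =1 e'.
Proof.
rewrite /req /= => E i.
have /den_inj/(_ i) : den l (fun i => zpos (e i) + zneg (e' i))%N
    = den l (fun i => zpos (e' i) + zneg (e i))%N.
  by rewrite !(den_add (fun=> erefl)).
by case: (e i) (e' i) => a [] b /=; lia.
Qed.

Lemma req_mono (e e' : 'I_n -> int) : e =1 e' -> req l (mono l e) (mono l e').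
Proof.
by move=> E; rewrite /req /=; congr (_ * _); apply: eq_bigr => i _; rewrite E.
Qed.

(** * Fractions and their expansions *)

Lemma den_lreg k : GRing.lreg (den l k).
Proof. by apply: monic_lreg; apply: monic_prod => i _; rewrite monic_exp // monicXaddC. Qed.

(** Clearing the denominator of [a] must turn the expansion into the numerator. Since denominators
    act bijectively, this determines [D]. *)
Definition represents D (a : Rd q n) := act (den l a.2) D = pconst a.1.

Lemma pconst_inj p r : pconst p = pconst r -> p = r.
Proof. by case. Qed.

(* The condition on the right no longer mentions the exponents of [u]: in the
   coordinate [P / mono e], right multiplication is a fixed operation. *)
Lemma req_dlmul (eu ev : 'I_n -> int) (x : DLgroup q n) Du Dv Pu Pv :
  (forall i, ev i = eu i + x.1 i) -> represents Du Pu -> represents Dv Pv ->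
  req l (rmul (mono l ev) Pv) (dlmul l (eu, rmul (mono l eu) Pu) x).2 <->
  act (den l (fun i => zpos (x.1 i)) * den l x.2.2) Dv =
  act (den l (fun i => zneg (x.1 i))) (pconst x.2.1 + act (den l x.2.2) Du).
Proof.
case: x => ex [Px kx] /= evE repu repv.
set a := den l (fun i => zpos (ex i)); set b := den l (fun i => zneg (ex i)).
pose up := den l (fun i => zpos (eu i)); pose um := den l (fun i => zneg (eu i)).
pose vp := den l (fun i => zpos (ev i)); pose vm := den l (fun i => zneg (ev i)).
(* Cross-multiplied form of the fact that the monomial of [ev] is the product of those of [eu] and
   [ex]. *)
have I : vp * um * b = up * a * vm.
  rewrite /vp /um /b /up /a /vm -!(den_add (fun=> erefl)).
  apply: eq_bigr => i _; congr (_ ^+ _); rewrite evE.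
  by move: (zpos_sub_zneg (eu i)) (zpos_sub_zneg (ex i)) (zpos_sub_zneg (eu i + ex i)); lia.
(* Acting by [M * b] clears all denominators: both sides become polynomials, namely the two sides of
   the cross-multiplied [req], each times [b * b]. The monic factors [b] then cancel. *)
pose M := up * vm * um * den l Pu.2 * den l Pv.2.
have regM : regular_action (M * b).
  by do ![apply: regular_actM]; apply: regular_act_den.
have -> : req l (rmul (mono l ev) Pv) (radd l (rmul (mono l eu) (Px, kx)) (rmul (mono l eu) Pu)) <->
   act (M * b) (act (a * den l kx) Dv) =
   act (M * b) (act b (pconst Px + act (den l kx) Du)).
  rewrite /req /= !(den_add (fun=> erefl)) -/up -/um -/vp -/vm.
  have -> : act (M * b) (act (a * den l kx) Dv) =
    pconst (vp * Pv.1 * (um * den l kx * (um * den l Pu.2)) * b * b).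
    rewrite -actM; have -> : M * b * (a * den l kx) =
      (vp * um * b) * um * den l Pu.2 * den l kx * b * den l Pv.2.
      by rewrite I /M; ring.
    by rewrite actM repv act_pconst; congr pconst; ring.
  have -> : act (M * b) (act b (pconst Px + act (den l kx) Du)) =
    pconst ((up * Px * (um * den l Pu.2) + up * Pu.1 * (um * den l kx))
            * (vm * den l Pv.2) * b * b).
    rewrite -actM actDr act_pconst -actM.
    have -> : M * b * b * den l kx = up * vm * um * den l Pv.2 * b * b * den l kx * den l Pu.2.
      by rewrite /M; ring.
    rewrite actM repu act_pconst; congr (_, _) => /=; last by rewrite addr0.
    by rewrite /M; ring.
  split=> [->//|/pconst_inj].
  by rewrite ![_ * b]mulrC => /den_lreg/den_lreg.
by split=> [/(regular_act_inj regM) //|->].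
Qed.

Lemma act_polar0 p D j : D.2 j = 0 -> (act p D).2 j = 0.
Proof.
move=> D0; elim/poly_ind: p => [|p c IHp]; first by rewrite act0l ffunE.
rewrite actDl actMX actC !ffunE D0 IHp drop_poly0r !scaler0.
by rewrite subrr addr0.
Qed.

Lemma act_xl_exp_polar i m D : (act (xl i ^+ m) D).2 i = drop_poly m (D.2 i).
Proof.
elim: m => [|m IHm]; first by rewrite expr0 act1 drop_poly0l.
rewrite exprS actM act_xl ffunE IHm subrr scale0r addr0.
by apply/polyP => k; rewrite !coef_drop_poly -addnA add1n.
Qed.

(** [N] bounds the length of every polar part, so multiplying by all [xl j ^+ N] leaves only a
    polynomial, the numerator. *)
Definition to_fraction D : Rd q n :=
  let N := \max_j size (D.2 j) in ((act (den l (fun=> N)) D).1, fun=> N).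

Lemma represents_to_fraction D : represents D (to_fraction D).
Proof.
rewrite /represents /to_fraction /=; set N := \max_j _; set k := fun=> N.
rewrite [LHS]surjective_pairing; congr (_, _); apply/ffunP => j; rewrite [RHS]ffunE.
(* The factor at [j] acts first and drops every digit at the pole [j]; the remaining factors cannot
   create new ones there. *)
rewrite /den (bigD1 j) //= mulrC actM act_polar0 // act_xl_exp_polar drop_poly_eq0 //.
exact: (leq_bigmax j).
Qed.

Lemma req_to_fraction_inj (eu ev : 'I_n -> int) Du Dv : eu =1 ev ->
  req l (rmul (mono l eu) (to_fraction Du)) (rmul (mono l ev) (to_fraction Dv)) -> Du = Dv.
Proof.
move=> e_eq; move: (represents_to_fraction Du) (represents_to_fraction Dv).
move: (to_fraction Du) (to_fraction Dv) => Pu Pv repu repv.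
rewrite /req /= !(den_add (fun=> erefl)).
have -> : den l (fun i => zpos (ev i)) = den l (fun i => zpos (eu i)).
  by apply: eq_bigr => i _; rewrite e_eq.
have -> : den l (fun i => zneg (ev i)) = den l (fun i => zneg (eu i)).
  by apply: eq_bigr => i _; rewrite e_eq.
rewrite -!mulrA => /den_lreg; rewrite mulrCA [RHS]mulrCA => /den_lreg PQ.
apply: (@regular_act_inj (den l Pu.2 * den l Pv.2)).
  by apply: regular_actM; apply: regular_act_den.
rewrite [in RHS]actM repv mulrC actM repu !act_pconst.
by rewrite mulrC PQ mulrC.
Qed.

Lemma req_to_fraction_surj (e : 'I_n -> int) (P : Rd q n) :
  exists D, req l (rmul (mono l e) (to_fraction D)) P.
Proof.
have [||_ surj] := @regular_actM (den l (fun i => zpos (e i))) (den l P.2).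
- exact: regular_act_den.
- exact: regular_act_den.
(* [D] is the expansion of [P / mono e], found by solving the equation with denominators cleared. *)
have [D DE] := surj (act (den l (fun i => zneg (e i))) (pconst P.1)).
exists D; move: (represents_to_fraction D); move: (to_fraction D) => Q repD.
rewrite /req /= (den_add (fun=> erefl)); apply: pconst_inj.
rewrite -mulrA [Q.1 * _]mulrC mulrA -act_pconst -repD actCA DE.
by rewrite !act_pconst; congr pconst; ring.
Qed.

(** * Generators as affine relations *)

Definition affine (c : 'Z_q * 'Z_q) : {poly 'Z_q} := c.1 *: 'X + c.2%:P.

Lemma affine1 : affine (0, 1) = 1.
Proof. by rewrite /affine scale0r add0r. Qed.

Lemma affine_xl i : affine (1, l i) = xl i.
Proof. by rewrite /affine scale1r. Qed.

(** The three kinds of generators give [xl i E = D + b], [E = xl i D - b] and [xl i E = xl j D - b],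
    after cancelling a common linear factor, whose action is injective. Degree at most one on both
    sides is what makes the relation local in the digits. *)
Lemma in_S_affine x : in_S l x -> exists f g (b : 'Z_q),
  (forall i, x.1 i \in [:: 0; 1; -1]) /\
  forall D E,
  act (den l (fun i => zpos (x.1 i)) * den l x.2.2) E =
  act (den l (fun i => zneg (x.1 i))) (pconst x.2.1 + act (den l x.2.2) D) <->
  act (affine f) E = act (affine g) D + pconst b%:P.
Proof.
case=> i [b [->|->|[j [nij ->]]]] /=.
- exists (1, l i), (0, 1), b; split=> [m|D E].
    by rewrite /unitv; case: eqP.
  have -> : den l (fun m => zpos (unitv i m)) = xl i.
    by apply: den1 => m; rewrite /unitv; case: eqP.
  have -> : den l (fun m => zneg (unitv i m)) = 1.
    by apply: den0 => m; rewrite /unitv; case: eqP.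
  by rewrite affine1 affine_xl den0 // mulr1 !act1 addrC.
- exists (0, 1), (1, l i), (- b); split=> [m|D E].
    by rewrite /unitv; case: eqP.
  have xp : den l (fun m => zpos (- unitv i m)) = 1.
    by apply: den0 => m; rewrite /unitv; case: eqP.
  have xn : den l (fun m => zneg (- unitv i m)) = xl i.
    by apply: den1 => m; rewrite /unitv; case: eqP.
  have -> : den l (fun m => zneg (- unitv i m) + 0)%N = xl i.
    by apply: den1 => m; rewrite addn0 /unitv; case: eqP.
  rewrite xp xn affine1 affine_xl !mul1r act1 addrC -polyCN.
  by split=> [/(regular_act_inj (regular_act_xl i))|->].
exists (1, l i), (1, l j), (- b); split=> [m|D E].
  rewrite /unitv; case: eqP => [<-|]; case: eqP => //.
have -> : den l (fun m => zpos (unitv i m - unitv j m)) = xl i.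
  apply: den1 => m; rewrite /unitv; move: nij.
  by case: (eqVneq i m) => [->|]; case: (eqVneq j m) => // ->; rewrite ?eqxx.
have -> : den l (fun m => zneg (unitv i m - unitv j m)) = xl j.
  apply: den1 => m; rewrite /unitv; move: nij.
  by case: (eqVneq i m) => [->|]; case: (eqVneq j m) => // ->; rewrite ?eqxx.
have -> : den l (fun m => if j == m then 1%N else 0%N) = xl j.
  by apply: den1 => m; case: eqP.
rewrite !affine_xl mulrC actM -polyCN addrC.
by split=> [/(regular_act_inj (regular_act_xl j))|->].
Qed.

End PartialFractions.

(** * Exponents in signed unary *)

Section Tracks.
Implicit Types (e : int) (t : seq (option bool)) (a b : option bool).

(** The sign fills the first [|e|] cells; [Negz m] is [-(m+1)], hence the [m.+1]. *)
Definition track e p : option bool :=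
  match e with
  | Posz m => if (p < m)%N then Some true else None
  | Negz m => if (p < m.+1)%N then Some false else None
  end.

Definition track_ok a a' := (a' == None) || (a == a').

Definition track_val t : int :=
  let m := find (pred1 None) t in
  match nth None t 0 with Some true => Posz m | Some false => Negz m.-1 | None => 0 end.

Lemma track_is_ok e p : track_ok (track e p) (track e p.+1).
Proof. by case: e => m; rewrite /track /track_ok; do 2![case: ltnP => ?] => //; lia. Qed.

Lemma track_default e p : (`|e| <= p)%N -> track e p = None.
Proof. by case: e => m /= le_p; case: ltnP => //; lia. Qed.

Lemma track_inj e e' : track e =1 track e' -> e = e'.
Proof.
case: e e' => m [] m' E.
- have := E m; have := E m'; rewrite /= !ltnn; case: ltnP => // le1 _; case: ltnP => // le2 _.
  by congr Posz; apply/eqP; rewrite eqn_leq le1 le2.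
- by have := E 0%N; rewrite /=; case: ltnP.
- by have := E 0%N; rewrite /=; case: ltnP.
have := E m; have := E m'; rewrite /= !ltnSn !ltnS.
case: leqP => // le1 _; case: leqP => // le2 _.
by congr Negz; apply/eqP; rewrite eqn_leq le1 le2.
Qed.

Lemma track_valK t : (forall p, track_ok (nth None t p) (nth None t p.+1)) ->
  track (track_val t) =1 nth None t.
Proof.
move=> ok; set m := find (pred1 None) t.
have lt_m p : (p < m)%N -> nth None t p = nth None t 0.
  elim: p => // p IHp ltp; rewrite -IHp; last exact: ltnW.
  have /negbT/= := before_find None ltp.
  by case/orP: (ok p) => [-> //|/eqP].
have ge_m p : (m <= p)%N -> nth None t p = None.
  move/subnK <-; elim: (p - m)%N => [|i IHi].
    rewrite add0n; have [|le_m] := ltnP m (size t); last by rewrite nth_default.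
    by rewrite -has_find => /(nth_find None)/eqP.
  by rewrite addSn; apply/eqP; case/orP: (ok (i + m)%N) => // /eqP <-; rewrite IHi.
move=> p; rewrite /track_val -/m; case t0: (nth None t 0) => [[]|] /=.
- by case: ltnP => [/lt_m ->|/ge_m ->].
- have m_gt0: (0 < m)%N by case: posnP => // m0; rewrite ge_m // m0 in t0.
  by rewrite prednK //; case: ltnP => [/lt_m ->|/ge_m ->].
by case: (ltnP p m) => [/lt_m ->|/ge_m ->].
Qed.

Definition incr_start a b := (a == Some false) || (b == Some true).

(** Incrementing a nonnegative exponent adds a cell, so [b'] follows from [a] and [a']. Incrementing
    a negative one removes a cell, so its track moves left by one and [b] equals [a']. *)
Definition incr_step a b a' b' :=
  match a' with
  | Some true => b' == Some true
  | None => b' == (if a == Some true then Some true else None)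
  | Some false => true
  end && ((a == Some false) ==> (b == a')).

Lemma incr_track e : incr_start (track e 0) (track (e + 1) 0) /\
  forall p, incr_step (track e p) (track (e + 1) p) (track e p.+1) (track (e + 1) p.+1).
Proof.
case: e => [m|[|m]].
- have -> : Posz m + 1 = Posz m.+1 by lia.
  split=> [|p]; first by case: m.
  by rewrite /= !ltnS; do 3![case: ltnP => ?] => //; lia.
- by split=> // -[|p].
have -> : Negz m.+1 + 1 = Negz m by lia.
by split=> // p; rewrite /= !ltnS; do 3![case: leqP => ?] => //; lia.
Qed.

(** For a fixed track of [e] the rules determine every cell of the second track, and the track of
    [e + 1] obeys them. *)
Lemma incr_trackP e e' :
  incr_start (track e 0) (track e' 0) /\
    (forall p, incr_step (track e p) (track e' p) (track e p.+1) (track e' p.+1)) <->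
  e' = e + 1.
Proof.
split=> [[H0 H]|->]; last exact: incr_track.
have [K0 K] := incr_track e; apply: track_inj => p.
have [neg|nneg] := eqVneq (track e p) (Some false).
  have := H p; have := K p; rewrite /incr_step neg eqxx /=.
  by move=> /andP[_ /eqP ->] /andP[_ /eqP ->].
case: p nneg => [|p] nneg.
  move: H0 K0; rewrite /incr_start (negPf nneg) /=.
  by move=> /eqP -> /eqP ->.
have := H p; have := K p; rewrite /incr_step.
by case: (track e p.+1) nneg => [[]|] // _ /andP[/eqP -> _] /andP[/eqP -> _].
Qed.

(** The last case is meant for [s = -1], read as an increment with the two tracks exchanged. *)
Definition shift_start (s : int) a b :=
  if s == 0 then a == b else if s == 1 then incr_start a b else incr_start b a.

Definition shift_step (s : int) a b a' b' :=
  if s == 0 then a' == b' else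
  if s == 1 then incr_step a b a' b' else incr_step b a b' a'.

Lemma shift_trackP s e e' : s \in [:: 0; 1; -1] ->
  shift_start s (track e 0) (track e' 0) /\
    (forall p, shift_step s (track e p) (track e' p) (track e p.+1) (track e' p.+1)) <->
  e' = e + s.
Proof.
rewrite !inE /shift_start /shift_step => /or3P[] /eqP -> /=.
- rewrite addr0; split=> [[/eqP H0 H]|->]; last by [].
  by apply/esym/track_inj => -[|p] //; apply/eqP.
- exact: incr_trackP.
by rewrite incr_trackP; split=> ->; rewrite ?addrK ?subrK.
Qed.

End Tracks.

(** * The encoding of the group *)

Section Encoding.
Variables (q n : nat) (l : 'I_n -> 'Z_q).

(* The signs of the exponents, the digit of the polynomial part, the digits at the poles. *)
Definition column := ({ffun 'I_n -> option bool} * ('Z_q * {ffun 'I_n -> 'Z_q}))%type.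
Definition column0 : column := ([ffun=> None], (0, [ffun=> 0])).
Implicit Types (u v : seq column) (a b : column) (c : 'Z_q * 'Z_q).

Notation at_ u p := (nth column0 u p).

Definition exps u (j : 'I_n) : int := track_val [seq a.1 j | a <- u].

Definition digits u : pfrac q n :=
  (\poly_(p < size u) (at_ u p).2.1, [ffun j => \poly_(p < size u) (at_ u p).2.2 j]).

Definition tracks_ok a b := [forall j, track_ok (a.1 j) (b.1 j)].

Definition wf u := trimmed column0 u /\ forall p, tracks_ok (at_ u p) (at_ u p.+1).

(** The digits store [P / mono e], hence the multiplication by the monomial. *)
Definition decode u : DLgroup q n := (exps u, rmul (mono l (exps u)) (to_fraction l (digits u))).

Lemma coef_digits1 u p : (digits u).1`_p = (at_ u p).2.1.
Proof. by rewrite coef_poly; case: ltnP => // le_p; rewrite nth_default. Qed.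

Lemma coef_digits2 u j p : ((digits u).2 j)`_p = (at_ u p).2.2 j.
Proof. by rewrite ffunE coef_poly; case: ltnP => // le_p; rewrite nth_default //= ffunE. Qed.

Lemma track_exps u j p : wf u -> track (exps u j) p = (at_ u p).1 j.
Proof.
have nthE r : nth None [seq a.1 j | a <- u] r = (at_ u r).1 j.
  have [lt_r|le_r] := ltnP r (size u); first by rewrite (nth_map column0).
  by rewrite !nth_default ?size_map //= ffunE.
case=> _ ok; rewrite -nthE; apply: track_valK => r.
by rewrite !nthE; have /forallP := ok r; apply.
Qed.

Lemma wf_inj u v : wf u -> wf v -> exps u =1 exps v -> digits u = digits v -> u = v.
Proof.
move=> wu wv eq_e eq_d; apply: trimmed_inj wu.1 wv.1 _ => p.
rewrite [LHS]surjective_pairing [RHS]surjective_pairing; congr (_, _).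
  by apply/ffunP => j; rewrite -!track_exps // eq_e.
rewrite [LHS]surjective_pairing [RHS]surjective_pairing; congr (_, _).
  by rewrite -!coef_digits1 eq_d.
by apply/ffunP => j; rewrite -!coef_digits2 eq_d.
Qed.

Lemma wf_exists (e : 'I_n -> int) (D : pfrac q n) :
  exists u, [/\ wf u, exps u =1 e & digits u = D].
Proof.
pose f p : column := ([ffun j => track (e j) p], (D.1`_p, [ffun j => (D.2 j)`_p])).
have [|u tu uf] := @trimmed_exists _ column0 f.
  exists (\max_j absz (e j) + (size D.1 + \max_j size (D.2 j)))%N => p le_p.
  congr (_, (_, _)); [apply/ffunP => j| |apply/ffunP => j]; rewrite ?ffunE.
  - apply: track_default; apply: leq_trans le_p.
    by apply: leq_trans (leq_addr _ _); apply: (leq_bigmax j).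
  - by apply: nth_default; apply: leq_trans le_p; rewrite addnCA leq_addr.
  apply: nth_default; apply: leq_trans le_p; rewrite addnA.
  by apply: leq_trans (leq_addl _ _); apply: (leq_bigmax j).
have wu : wf u.
  by split=> // p; rewrite !uf; apply/forallP => j; rewrite !ffunE track_is_ok.
exists u; split=> // [j|].
  by apply: track_inj => p; rewrite track_exps // uf ffunE.
rewrite [LHS]surjective_pairing [RHS]surjective_pairing; congr (_, _).
  by apply/polyP => p; rewrite coef_digits1 uf.
by apply/ffunP => j; apply/polyP => p; rewrite coef_digits2 uf ffunE.
Qed.

(** * Regularity of the encoding and of multiplication *)

Lemma regular_wf : regular wf.
Proof.
have [M MP] := local_regular column0 predT tracks_ok.
by exists M => w; rewrite -MP; split=> [[tw ok]|[tw _ ok]].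
Qed.

(** These three are the digits of [affine c] acting on [digits u]: the constant coefficient, which
    receives the first digit of every pole, the higher coefficients, and the digits at pole [j]. *)
Definition affine_start c a := c.1 * (\sum_j a.2.2 j) + c.2 * a.2.1.
Definition affine_next c a a' := c.1 * a.2.1 + c.2 * a'.2.1.
Definition affine_polar c j a a' := c.1 * (a'.2.2 j - l j * a.2.2 j) + c.2 * a.2.2 j.

Lemma act_affine c u : let E := act l (affine c) (digits u) in
  [/\ E.1`_0 = affine_start c (at_ u 0),
      forall p, E.1`_p.+1 = affine_next c (at_ u p) (at_ u p.+1) &
      forall j p, (E.2 j)`_p = affine_polar c j (at_ u p) (at_ u p.+1)].
Proof.
move: (digits u) (@coef_digits1 u) (@coef_digits2 u) => D d1 d2 E.
rewrite /E /affine actDl actZl -['X]mul1r actMX act1 actC; split=> [|p|j p] /=.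
- rewrite coefD !coefZ coefD coefXM coefC /= add0r d1.
  by congr (_ * _ + _); apply: eq_bigr => j _; rewrite d2.
- by rewrite coefD !coefZ coefD coefXM coefC /= addr0 !d1.
by rewrite !ffunE coefD !coefZ coefB coefZ coef_drop_poly addn1 !d2.
Qed.

Definition step_start (s : 'I_n -> int) f g (y : 'Z_q) (ab : column * column) :=
  [forall j, shift_start (s j) (ab.1.1 j) (ab.2.1 j)] &&
  (affine_start f ab.2 == affine_start g ab.1 + y).

Definition step_next (s : 'I_n -> int) f g (ab ab' : column * column) :=
  [&& tracks_ok ab.1 ab'.1, tracks_ok ab.2 ab'.2,
      [forall j, shift_step (s j) (ab.1.1 j) (ab.2.1 j) (ab'.1.1 j) (ab'.2.1 j)],
      affine_next f ab.2 ab'.2 == affine_next g ab.1 ab'.1 &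
      [forall j, affine_polar f j ab.2 ab'.2 == affine_polar g j ab.1 ab'.1]].

Lemma step_affineP f g y u v :
  (affine_start f (at_ v 0) = affine_start g (at_ u 0) + y /\
   forall p, affine_next f (at_ v p) (at_ v p.+1) = affine_next g (at_ u p) (at_ u p.+1) /\
     forall j, affine_polar f j (at_ v p) (at_ v p.+1) = affine_polar g j (at_ u p) (at_ u p.+1))
  <-> act l (affine f) (digits v) = act l (affine g) (digits u) + pconst n y%:P.
Proof.
have [v0 vn vp] := act_affine f v; have [u0 un up] := act_affine g u.
split=> [[H0 H]|E].
  rewrite [LHS]surjective_pairing; congr (_, _).
    apply/polyP => -[|p]; rewrite coefD coefC /=; first by rewrite v0 u0.
    by rewrite vn un addr0 (H p).1.
  apply/ffunP => j; rewrite !ffunE addr0; apply/polyP => p.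
  by rewrite vp up (H p).2.
split=> [|p]; first by rewrite -v0 -u0 E coefD coefC.
split=> [|j]; first by rewrite -vn -un E coefD coefC addr0.
by rewrite -vp -up E !ffunE addr0.
Qed.

Lemma step_nextP (s : 'I_n -> int) f g y u v :
  (forall j, s j \in [:: 0; 1; -1]) ->
  trimmed column0 u -> trimmed column0 v ->
  (step_start s f g y (at_ u 0, at_ v 0) /\
   forall p, step_next s f g (at_ u p, at_ v p) (at_ u p.+1, at_ v p.+1)) <->
  [/\ wf u, wf v, forall j, exps v j = exps u j + s j &
      act l (affine f) (digits v) = act l (affine g) (digits u) + pconst n y%:P].
Proof.
move=> s_small tu tv; split.
  case=> /andP[/forallP/= e0 /eqP/= d0] H.
  have wu : wf u by split=> // p; case/and5P: (H p).
  have wv : wf v by split=> // p; case/and5P: (H p).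
  split=> // [j|].
    apply/shift_trackP => //; split=> [|p]; rewrite !track_exps //.
    by case/and5P: (H p) => _ _ /forallP.
  apply/step_affineP; split=> // p.
  by case/and5P: (H p) => _ _ _ /eqP ? /forallP K; split=> // j; apply/eqP/K.
case=> wu wv e_eq /step_affineP[d0 d].
have eP j := (shift_trackP (exps u j) (exps v j) (s_small j)).2 (e_eq j).
split=> [|p]; last (apply/and5P; split).
- apply/andP; split; last by apply/eqP.
  by apply/forallP => j /=; have [] := eP j; rewrite !track_exps.
- exact: wu.2.
- exact: wv.2.
- by apply/forallP => j /=; have [_ /(_ p)] := eP j; rewrite !track_exps.
- by apply/eqP; case: (d p).
- by apply/forallP => j; apply/eqP; apply: (d p).2.
Qed.

Hypothesis l_unit : forall i j, i != j -> l i - l j \is a GRing.unit.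

Lemma decode_surj (g : DLgroup q n) : exists u, wf u /\ dleq l (decode u) g.
Proof.
have [D DP] := req_to_fraction_surj l_unit g.1 g.2.
have [u [wu ue ud]] := wf_exists g.1 D.
exists u; split=> //; split=> /=; first exact: req_mono.
(* [exps u] and [g.1] agree only pointwise, so the exponents are exchanged inside the products
   [den]. *)
rewrite ud; have eqD k k' : k =1 k' -> den l k = den l k'.
  by move=> E; apply: eq_bigr => i _; rewrite E.
move: DP; rewrite /req /= !(den_add l (fun=> erefl)).
rewrite (eqD (fun i => zpos (exps u i)) (fun i => zpos (g.1 i))) => [|i]; last by rewrite ue.
by rewrite (eqD (fun i => zneg (exps u i)) (fun i => zneg (g.1 i))) // => i; rewrite ue.
Qed.

Lemma decode_inj u v : wf u -> wf v -> dleq l (decode u) (decode v) -> u = v.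
Proof.
move=> wu wv [/(req_mono_inj l_unit) e_eq] /(req_to_fraction_inj l_unit e_eq).
exact: wf_inj.
Qed.

(** [req_dlmul] removes the exponents from the equation for the entry, [in_S_affine] makes it
    affine, and [step_nextP] turns it, with the exponent shifts, into a condition on consecutive
    columns. *)
Lemma regular_mul x : in_S l x ->
  regular (fun w => exists u v,
    [/\ wf u, wf v, w = conv u v & dleq l (decode v) (dlmul l (decode u) x)]).
Proof.
case/(in_S_affine l_unit) => f [g [y [s_small act_eq]]].
have [M MP] := conv_regular column0 (step_start x.1 f g y) (step_next x.1 f g).
have dleqP u v : dleq l (decode v) (dlmul l (decode u) x) <->
    (forall j, exps v j = exps u j + x.1 j) /\
    act l (affine f) (digits v) = act l (affine g) (digits u) + pconst n y%:P.
  have mulP (e : forall j, exps v j = exps u j + x.1 j) := req_dlmul l_unit e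
    (represents_to_fraction l (digits u)) (represents_to_fraction l (digits v)).
  split=> [[/(req_mono_inj l_unit) e /(mulP e)/act_eq]|[e /act_eq/(mulP e)]] //.
  by move=> ?; split=> //; apply: req_mono.
exists M => w; rewrite -MP; split=> [[u [v [wu wv -> /dleqP[e d]]]]|].
  by exists u, v; split=> //; [case: wu | case: wv | apply/step_nextP => //; [case: wu|case: wv]].
case=> u [v [tu tv -> /(step_nextP _ _ _ s_small tu tv)[wu wv e d]]].
by exists u, v; split=> //; apply/dleqP.
Qed.

End Encoding.

Theorem theorem1p1 (q d : nat) (l : 'I_d.-1 -> 'Z_q) :
  (2 <= q)%N -> (3 <= d)%N -> injective l ->
  (forall i, l i \is a GRing.unit) ->
  (forall i j, i != j -> l i - l j \is a GRing.unit) ->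
  exists (Lam : finType) (L : seq Lam -> Prop) (bar : seq Lam -> DLgroup q d.-1),
    [/\ regular L,
        (forall g : DLgroup q d.-1, exists u, L u /\ dleq l (bar u) g),
        (forall u v, L u -> L v -> dleq l (bar u) (bar v) -> u = v) &
        (forall x : DLgroup q d.-1, in_S l x ->
           regular (fun w => exists u v,
             [/\ L u, L v, w = conv u v & dleq l (bar v) (dlmul l (bar u) x)]))].
Proof.
move=> _ _ _ _ l_unit.
exists (column q d.-1), (@wf q d.-1), (@decode q d.-1 l); split.
- exact: regular_wf.
- exact: decode_surj.
- by move=> u v; apply: decode_inj.
- exact: regular_mul.
Qed.
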